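(* Let $K$ be any field and let $H$ be any numerical semigroup. Then the type of $H$ equals the Cohen-Macaulay type of the semigroup ring $K[H]$, i.e. $\mathrm{t}(H)=\mathrm{t}(K[H])$.
   Context: A numerical semigroup $H$ is a subset of $\mathbb{N}=\{0,1,2,\dots\}$ that contains $0$, is closed under addition, and has $|\mathbb{N}\setminus H|<\infty$. The semigroup ring $K[H]$ is the $K$-subalgebra of the polynomial ring $K[t]$ generated by the monomials $t^h$ with $h\in H$; it is a one-dimensional Cohen-Macaulay domain. The set of pseudo-Frobenius numbers of $H$ is $PF(H)=\{x\in\mathbb{Z}\setminus H : x+h\in H \text{ for all } h\in H,\ h>0\}$, and the type of $H$ is $\mathrm{t}(H)=|PF(H)|$. The type of a Cohen-Macaulay local ring $(R,\mathfrak{m})$ with residue field $k=R/\mathfrak{m}$ and Krull dimension $d$ is $\mathrm{t}(R)=\dim_{k}\mathrm{Ext}^d_R(k,R)$. The type of a (not necessarily local) Cohen-Macaulay ring $R$ is the maximum of $\mathrm{t}(R_{\mathfrak{p}})$, where $\mathfrak{p}$ ranges over the maximal ideals of $R$. *)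

(* Defs.v *)
From HB Require Import structures.
From mathcomp Require Import all_boot all_order all_algebra.
From mathcomp Require Import generic_quotient ring_quotient.
From mathcomp Require Import finmap.
From mathcomp Require Import boolp classical_sets functions cardinality.
From mathcomp Require Import freeg ring.

Set Implicit Arguments.
Unset Strict Implicit.
Unset Printing Implicit Defensive.

Import GRing.Theory.

Local Open Scope classical_set_scope.
Local Open Scope quotient_scope.
Local Open Scope ring_scope.

(** * Numerical semigroups *)

Record numerical_semigroup (H : set nat) : Prop := NumericalSemigroup {
  nsg0 : H 0%N;
  nsgD : forall a b, H a -> H b -> H (a + b)%N;
  nsg_cofinite : finite_set (~` H)
}.

Definition nat_in_int (H : set nat) : set int := [set h%:Z | h in H].

Definition PF (H : set nat) : set int :=
  [set x | ~ nat_in_int H x /\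
           forall h, H h -> (0 < h)%N -> nat_in_int H (x + h%:Z)].

Lemma PF_finite (H : set nat) : numerical_semigroup H -> finite_set (PF H).
Proof.
case=> _ _ Hfin.
have [h Hh h_gt0] : exists2 h, H h & (0 < h)%N.
  apply: contrapT => nH; apply: infinite_nat.
  apply: (@sub_finite_set _ _ ([set 0%N] `|` ~` H)); last by rewrite finite_setU.
  move=> n _ /=; case: (posnP n) => [->|n_gt0]; [by left|right=> Hn].
  by apply: nH; exists n.
have fin : finite_set ((fun n : nat => n%:Z - h%:Z) @` `I_h `|` Posz @` (~` H)).
  by rewrite finite_setU; split; apply: finite_image => //; exact: finite_II.
apply: sub_finite_set fin => x [xH /(_ h Hh h_gt0)[n Hn /= nE]].
have xE : n%:Z - h%:Z = x by rewrite nE addrK.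
have [hn|nh] := leqP h n; [right|by left; exists n].
have xE' : (n - h)%N%:Z = x by rewrite -subzn.
by exists (n - h)%N => //= Hnh; apply: xH; exists (n - h)%N.
Qed.

(* [PF_finite] shows that [fset_set] has no junk value here. *)
Definition semigroup_type (H : set nat) : nat := #|` fset_set (PF H)|%fset.

(** * The semigroup ring *)

Section SemigroupRing.
Variables (K : fieldType) (H : set nat).

(* The subalgebra generated by the monomials 'X^h is the intersection of all
   the K-subalgebras that contain them. *)
Definition sgring_pred : {pred {poly K}} := fun p =>
  `[< forall S : {pred {poly K}}, subalg_closed S ->
        (forall h, H h -> 'X^h \in S) -> p \in S >].

Lemma sgring_subalg : subalg_closed sgring_pred.
Proof.
split=> [|a u v|u v]; rewrite !unfold_in.
- by apply/asboolP => S [].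
- move=> /asboolP hu /asboolP hv; apply/asboolP => S Sc SH.
  by have [_ SD _] := Sc; apply: SD; [apply: hu|apply: hv].
- move=> /asboolP hu /asboolP hv; apply/asboolP => S Sc SH.
  by have [_ _ SM] := Sc; apply: SM; [apply: hu|apply: hv].
Qed.

HB.instance Definition _ :=
  GRing.isSubalgClosed.Build K {poly K} sgring_pred sgring_subalg.

Record semigroup_ring :=
  SemigroupRing { sgval :> {poly K}; _ : sgval \in sgring_pred }.

HB.instance Definition _ := [isSub for sgval].
HB.instance Definition _ := [Choice of semigroup_ring by <:].
HB.instance Definition _ := [SubChoice_isSubComNzRing of semigroup_ring by <:].

End SemigroupRing.

(** * Ideals, Krull dimension *)

Section Ideals.
Variable R : comNzRingType.

(* Elements of [idealr R] are proper ideals. *)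
Definition maximal_ideal (m : idealr R) : Prop :=
  forall I : idealr R, {subset m <= I} -> {subset I <= m}.

Definition local_ring (m : idealr R) : Prop :=
  maximal_ideal m /\ forall I : idealr R, maximal_ideal I -> I =i m.

Definition prime_chain (n : nat) : Prop :=
  exists P : 'I_n.+1 -> prime_idealr R, forall i j : 'I_n.+1, (i < j)%N ->
    {subset P i <= P j} /\ ~ {subset P j <= P i}.

Definition krull_dim (d : nat) : Prop :=
  prime_chain d /\ forall n, prime_chain n -> (n <= d)%N.

End Ideals.

(** * Localization at a prime ideal *)

Section Localization.
Variables (R : comNzRingType) (p : prime_idealr R).

Record frac := Frac { fnum : R; fden : R; _ : fden \notin p }.

Lemma fdenP (x : frac) : fden x \notin p. Proof. by case: x. Qed.

Let frac_code (x : frac) : {y : R * R | y.2 \notin p} :=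
  exist _ (fnum x, fden x) (fdenP x).
Let frac_decode (y : {y : R * R | y.2 \notin p}) : frac := Frac (sval y).1 (svalP y).
Let frac_codeK : cancel frac_code frac_decode.
Proof. by case=> a s sp; congr Frac; exact: bool_irrelevance. Qed.
HB.instance Definition _ := Choice.copy frac (can_type frac_codeK).

(* a / s = b / t in R_p *)
Definition frac_eq (x y : frac) : bool :=
  `[< exists2 u, u \notin p & u * (fnum x * fden y - fnum y * fden x) = 0 >].

Lemma notin_primeM u v : u \notin p -> v \notin p -> u * v \notin p.
Proof. by move=> up vp; rewrite prime_idealrM negb_or up. Qed.

Lemma notin_prime1 : 1 \notin p. Proof. by rewrite idealr1. Qed.

Lemma frac_eq_refl : reflexive frac_eq.
Proof. by move=> x; apply/asboolP; exists 1; rewrite ?notin_prime1 ?subrr ?mulr0. Qed.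

Lemma frac_eq_sym : symmetric frac_eq.
Proof.
by move=> x y; apply/asboolP/asboolP => -[u up e]; exists u => //;
  apply: oppr_inj; rewrite -mulrN opprB e oppr0.
Qed.

Lemma frac_eq_trans : transitive frac_eq.
Proof.
move=> y x z /asboolP[u up e] /asboolP[v vp f]; apply/asboolP.
exists (u * v * fden y); first by rewrite !notin_primeM ?fdenP.
transitivity (v * fden z * (u * (fnum x * fden y - fnum y * fden x))
              + u * fden x * (v * (fnum y * fden z - fnum z * fden y))).
  by ring.
by rewrite e f !mulr0 addr0.
Qed.

Canonical frac_equiv := EquivRel frac_eq frac_eq_refl frac_eq_sym frac_eq_trans.

Definition localization := {eq_quot frac_equiv}.
HB.instance Definition _ := Choice.on localization.
HB.instance Definition _ : EqQuotient _ frac_equiv localization :=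
  EqQuotient.on localization.

Definition frac0 := Frac 0 notin_prime1.
Definition frac1 := Frac 1 notin_prime1.
Definition frac_opp x := Frac (- fnum x) (fdenP x).
Definition frac_add x y :=
  Frac (fnum x * fden y + fnum y * fden x) (notin_primeM (fdenP x) (fdenP y)).
Definition frac_mul x y :=
  Frac (fnum x * fnum y) (notin_primeM (fdenP x) (fdenP y)).

Lemma fracP (x y : frac) :
  reflect (exists2 u, u \notin p & u * (fnum x * fden y - fnum y * fden x) = 0)
          (x == y %[mod localization]).
Proof. by rewrite piE; exact: asboolP. Qed.

Lemma frac_same (x y : frac) :
  fnum x * fden y = fnum y * fden x -> x = y %[mod localization].
Proof.
move=> e; apply/eqP/fracP; exists 1; first exact: notin_prime1.
by rewrite e subrr mulr0.
Qed.

Definition loc_opp := lift_op1 localization frac_opp.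
Definition loc_add := lift_op2 localization frac_add.
Definition loc_mul := lift_op2 localization frac_mul.

Lemma pi_loc_opp : {morph \pi_localization : x / frac_opp x >-> loc_opp x}.
Proof.
move=> x; unlock loc_opp; apply/eqP/fracP.
have /eqP/fracP[u up e] := reprK (\pi_localization x).
exists u => //=; apply: etrans e.
by ring.
Qed.
Canonical pi_loc_opp_morph := PiMorph1 pi_loc_opp.

Lemma pi_loc_add : {morph \pi_localization : x y / frac_add x y >-> loc_add x y}.
Proof.
move=> x y; unlock loc_add; apply/eqP/fracP.
have /eqP/fracP[u up e] := reprK (\pi_localization x).
have /eqP/fracP[v vp f] := reprK (\pi_localization y).
exists (u * v) => /=; first exact: notin_primeM.
move: (repr _) (repr _) e f => y' x' e f.
transitivity (- (v * fden y * fden y'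
     * (u * (fnum x' * fden x - fnum x * fden x')))
   - u * fden x * fden x' * (v * (fnum y' * fden y - fnum y * fden y'))).
  by ring.
by rewrite e f !mulr0 oppr0 addr0.
Qed.
Canonical pi_loc_add_morph := PiMorph2 pi_loc_add.

Lemma pi_loc_mul : {morph \pi_localization : x y / frac_mul x y >-> loc_mul x y}.
Proof.
move=> x y; unlock loc_mul; apply/eqP/fracP.
have /eqP/fracP[u up e] := reprK (\pi_localization x).
have /eqP/fracP[v vp f] := reprK (\pi_localization y).
exists (u * v) => /=; first exact: notin_primeM.
move: (repr _) (repr _) e f => y' x' e f.
transitivity (- (v * fnum y * fden y'
     * (u * (fnum x' * fden x - fnum x * fden x')))
   - u * fden x * fnum x' * (v * (fnum y' * fden y - fnum y * fden y'))).
  by ring.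
by rewrite e f !mulr0 oppr0 addr0.
Qed.
Canonical pi_loc_mul_morph := PiMorph2 pi_loc_mul.

Definition loc0 : localization := \pi frac0.
Definition loc1 : localization := \pi frac1.

Fact loc_addA : associative loc_add.
Proof.
elim/quotW=> x; elim/quotW=> y; elim/quotW=> z; rewrite !piE.
by apply: frac_same => /=; ring.
Qed.

Fact loc_addC : commutative loc_add.
Proof.
by elim/quotW=> x; elim/quotW=> y; rewrite !piE; apply: frac_same => /=; ring.
Qed.

Fact loc_add0 : left_id loc0 loc_add.
Proof.
by elim/quotW=> x; rewrite /loc0 !piE; apply: frac_same => /=; ring.
Qed.

Fact loc_addN : left_inverse loc0 loc_opp loc_add.
Proof.
by elim/quotW=> x; rewrite /loc0 !piE; apply: frac_same => /=; ring.
Qed.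

Fact loc_mulA : associative loc_mul.
Proof.
elim/quotW=> x; elim/quotW=> y; elim/quotW=> z; rewrite !piE.
by apply: frac_same => /=; ring.
Qed.

Fact loc_mulC : commutative loc_mul.
Proof.
by elim/quotW=> x; elim/quotW=> y; rewrite !piE; apply: frac_same => /=; ring.
Qed.

Fact loc_mul1 : left_id loc1 loc_mul.
Proof.
by elim/quotW=> x; rewrite /loc1 !piE; apply: frac_same => /=; ring.
Qed.

Fact loc_mulDl : left_distributive loc_mul loc_add.
Proof.
elim/quotW=> x; elim/quotW=> y; elim/quotW=> z; rewrite !piE.
by apply: frac_same => /=; ring.
Qed.

Fact loc1_neq0 : loc1 != loc0.
Proof.
apply/negP => /fracP[u up /=]; rewrite !mulr1 subr0 => u0.
by rewrite mulr1 in u0; rewrite u0 rpred0 in up.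
Qed.

HB.instance Definition _ :=
  GRing.isZmodule.Build localization loc_addA loc_addC loc_add0 loc_addN.
HB.instance Definition _ := GRing.Zmodule_isComNzRing.Build localization
  loc_mulA loc_mulC loc_mul1 loc_mulDl loc1_neq0.

End Localization.

(** * Constructions on modules *)

(* The residue ring R / m, as an R-module. *)
Section Residue.
Variables (R : comNzRingType) (m : idealr R).

Definition residue := {ideal_quot m}.
HB.instance Definition _ := GRing.ComNzRing.on residue.

Definition residue_scale (a : R) (x : residue) : residue :=
  (\pi_{ideal_quot m} a : residue) * x.

Fact residue_scaleA a b x :
  residue_scale a (residue_scale b x) = residue_scale (a * b) x.
Proof. by rewrite /residue_scale (rmorphM (\pi_{ideal_quot m})) mulrA. Qed.
Fact residue_scale1 : left_id 1 residue_scale.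
Proof. by move=> x; rewrite /residue_scale (rmorph1 (\pi_{ideal_quot m})) mul1r. Qed.
Fact residue_scaleDr : right_distributive residue_scale +%R.
Proof. by move=> a x y; rewrite /residue_scale mulrDr. Qed.
Fact residue_scaleDl x : {morph residue_scale^~ x : a b / a + b}.
Proof. by move=> a b; rewrite /residue_scale (rmorphD (\pi_{ideal_quot m})) mulrDl. Qed.

HB.instance Definition _ := GRing.Zmodule_isLmodule.Build R residue
  residue_scaleA residue_scale1 residue_scaleDr residue_scaleDl.

End Residue.

Section KernelModule.
Variables (R : comNzRingType) (U V : lmodType R) (f : {linear U -> V}).

Definition ker_pred : {pred U} := fun x => f x == 0.

Lemma ker_submod : submod_closed ker_pred.
Proof.
split=> [|a x y]; rewrite !unfold_in ?linear0 // => /eqP fx /eqP fy.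
by rewrite linearP fx fy scaler0 addr0.
Qed.

HB.instance Definition _ := GRing.isSubmodClosed.Build R U ker_pred ker_submod.

Record kermod := KerMod { kerval :> U; _ : kerval \in ker_pred }.
HB.instance Definition _ := [isSub for kerval].
HB.instance Definition _ := [Choice of kermod by <:].
HB.instance Definition _ := [SubChoice_isSubZmodule of kermod by <:].
HB.instance Definition _ := [SubZmodule_isSubLmodule of kermod by <:].

End KernelModule.

Section QuotientModule.
Variables (R : comNzRingType) (V : lmodType R) (W : {pred V}).
Variable Wsub : submod_closed W.

Definition submod_zmodClosed : zmodClosed V :=
  HB.pack_for (zmodClosed V) (W : V -> bool)
    (GRing.isZmodClosed.Build V W (GRing.submod_closedB Wsub)).

Definition quotmod := Quotient.quot submod_zmodClosed.
HB.instance Definition _ := GRing.Zmodule.on quotmod.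

Definition quotmod_pi (v : V) : quotmod := \pi_(Quotient.quot submod_zmodClosed) v.

Definition quotmod_scale (a : R) (x : quotmod) : quotmod :=
  quotmod_pi (a *: repr x).

Lemma pi_quotmod_scale a v :
  quotmod_scale a (quotmod_pi v) = quotmod_pi (a *: v).
Proof.
apply/eqP; rewrite -(Quotient.idealrBE submod_zmodClosed) -scalerBr.
have [W0 WD] := Wsub.
have : repr (quotmod_pi v) - v \in submod_zmodClosed.
  by rewrite Quotient.idealrBE; apply/eqP; exact: reprK.
by move=> Wv; rewrite -[_ *: _]addr0; apply: WD.
Qed.

Fact quotmod_scaleA a b x :
  quotmod_scale a (quotmod_scale b x) = quotmod_scale (a * b) x.
Proof. by rewrite {2}/quotmod_scale pi_quotmod_scale scalerA. Qed.
Fact quotmod_scale1 : left_id 1 quotmod_scale.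
Proof. by move=> x; rewrite /quotmod_scale scale1r; exact: reprK. Qed.
Fact quotmod_scaleDr : right_distributive quotmod_scale +%R.
Proof.
move=> a; elim/quotW=> x; elim/quotW=> y.
rewrite -(raddfD \pi_(Quotient.quot submod_zmodClosed)).
rewrite -![\pi_(_) _]/(quotmod_pi _) !pi_quotmod_scale scalerDr.
exact: (raddfD \pi_(Quotient.quot submod_zmodClosed)).
Qed.
Fact quotmod_scaleDl x : {morph quotmod_scale^~ x : a b / a + b}.
Proof.
move=> a b; rewrite /quotmod_scale scalerDl.
exact: (raddfD \pi_(Quotient.quot submod_zmodClosed)).
Qed.

HB.instance Definition _ := GRing.Zmodule_isLmodule.Build R quotmod
  quotmod_scaleA quotmod_scale1 quotmod_scaleDr quotmod_scaleDl.

End QuotientModule.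

Section HomModule.
Variables (R : comNzRingType) (U V : lmodType R).

Definition hom_pred : {pred U -> V} := fun f => `[< linear f >].

Lemma hom_submod : submod_closed hom_pred.
Proof.
split=> [|a f g]; rewrite !unfold_in.
  by apply/asboolP => b x y; rewrite scaler0 addr0.
move=> /asboolP fl /asboolP gl; apply/asboolP => b x y.
rewrite /= !fctE fl gl !scalerDr !scalerA (mulrC a b).
by rewrite !addrA; congr (_ + _); rewrite addrAC.
Qed.

HB.instance Definition _ :=
  GRing.isSubmodClosed.Build R (U -> V) hom_pred hom_submod.

Record linhom := LinHom { homval :> U -> V; _ : homval \in hom_pred }.
HB.instance Definition _ := [isSub for homval].
HB.instance Definition _ := [Choice of linhom by <:].
HB.instance Definition _ := [SubChoice_isSubZmodule of linhom by <:].
HB.instance Definition _ := [SubZmodule_isSubLmodule of linhom by <:].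

Lemma hom_linear (f : linhom) : linear f.
Proof. by have := valP f; rewrite unfold_in => /asboolP. Qed.

HB.instance Definition _ (f : linhom) :=
  GRing.isLinear.Build R U V *:%R (homval f) (hom_linear f).

End HomModule.

(* Precomposition Hom(V, N) -> Hom(U, N) with a linear map U -> V. *)
Section Precomposition.
Variables (R : comNzRingType) (U V N : lmodType R) (d : {linear U -> V}).

Fact precomp_subproof (f : linhom V N) : (f \o d) \in @hom_pred R U N.
Proof. by rewrite unfold_in; apply/asboolP => a x y; rewrite /= !linearP. Qed.

Definition precomp (f : linhom V N) : linhom U N := LinHom (precomp_subproof f).

Fact precomp_linear : linear precomp.
Proof. by move=> a f g; apply/val_inj. Qed.

HB.instance Definition _ :=
  GRing.isLinear.Build R (linhom V N) (linhom U N) *:%R precomp precomp_linear.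

End Precomposition.

(* The homology ker g / im f of A --f--> B --g--> C, for g \o f = 0. *)
Section Homology.
Variables (R : comNzRingType) (A B C : lmodType R).
Variables (f : {linear A -> B}) (g : {linear B -> C}).

Definition boundary : {pred kermod g} := fun z => `[< exists a, f a = val z >].

Lemma boundary_submod : submod_closed boundary.
Proof.
split=> [|a x y]; rewrite !unfold_in.
  by apply/asboolP; exists 0; rewrite linear0.
move=> /asboolP[u fu] /asboolP[v fv]; apply/asboolP; exists (a *: u + v).
by rewrite linearP fu fv.
Qed.

Definition homology : lmodType R := quotmod boundary_submod.

End Homology.

(** * Ext *)

Section Ext.
Variable R : comNzRingType.

(* The free module on the underlying set of M, mapped onto M. *)
Definition free_cover (M : lmodType R) : lmodType R := {freeg M / R}.

Definition free_aug (M : lmodType R) : free_cover M -> M := fglift id.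

Fact free_aug_additive (M : lmodType R) : zmod_morphism (@free_aug M).
Proof. exact: (lift_is_additive id). Qed.

HB.instance Definition _ (M : lmodType R) :=
  GRing.isZmodMorphism.Build (free_cover M) M (@free_aug M)
    (@free_aug_additive M).

Fact free_aug_scalable (M : lmodType R) : scalable (@free_aug M).
Proof.
move=> a x; rewrite -[x in RHS]freeg_sumE [a *: x]/(fgscale a x) /fgscale.
rewrite [LHS]raddf_sum [X in _ *: X]raddf_sum scaler_sumr; apply: eq_bigr => z _.
by rewrite /= /free_aug !liftU scalerA.
Qed.

HB.instance Definition _ (M : lmodType R) :=
  GRing.isScalable.Build R (free_cover M) M *:%R (@free_aug M)
    (@free_aug_scalable M).

Lemma free_aug_surj (M : lmodType R) (x : M) : exists y, free_aug y = x :> M.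
Proof.
by exists << x >>; rewrite /free_aug liftU scale1r.
Qed.

(* The canonical free resolution ... -> F_1 -> F_0 -> M -> 0: F_n is the free
   cover of the n-th syzygy of M, and F_(n+1) maps onto the (n+1)-th syzygy,
   which is the kernel of F_n -> (n-th syzygy). *)
Definition syzygy (n : nat) (M : lmodType R) : lmodType R :=
  iter n (fun N : lmodType R => kermod (@free_aug N) : lmodType R) M.

Definition resolution (M : lmodType R) (n : nat) : lmodType R :=
  free_cover (syzygy n M).

Definition res_diff (M : lmodType R) (n : nat) (x : resolution M n.+1) :
    resolution M n :=
  kerval (free_aug x : kermod (@free_aug (syzygy n M))).

Fact res_diff_linear (M : lmodType R) (n : nat) : linear (@res_diff M n).
Proof.
move=> a x y; rewrite /res_diff linearP.
exact: (linearP (val : kermod (@free_aug (syzygy n M)) -> _)).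
Qed.

HB.instance Definition _ (M : lmodType R) (n : nat) :=
  GRing.isLinear.Build R (resolution M n.+1) (resolution M n) *:%R
    (@res_diff M n) (@res_diff_linear M n).

Lemma res_diff_exact0 (M : lmodType R) (x : resolution M 0) :
  free_aug x = 0 <-> exists y, @res_diff M 0 y = x.
Proof.
split=> [x0|[y <-]]; last first.
  by apply/eqP; rewrite /res_diff; case: (free_aug y).
have [y yE] := free_aug_surj (KerMod (introT eqP x0)).
by exists y; rewrite /res_diff yE.
Qed.

Lemma res_diff_exact (M : lmodType R) (n : nat) (x : resolution M n.+1) :
  @res_diff M n x = 0 <-> exists y, @res_diff M n.+1 y = x.
Proof.
have -> : res_diff x = 0 <-> free_aug x = 0 :> syzygy n.+1 M.
  by split=> [x0|x0]; [apply: val_inj|rewrite /res_diff x0].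
split=> [x0|[y <-]]; last first.
  by apply/eqP; rewrite /res_diff; case: (free_aug y).
have [y yE] := free_aug_surj (KerMod (introT eqP x0)).
by exists y; rewrite /res_diff yE.
Qed.

Definition codiff (M N : lmodType R) (n : nat) :
    linhom (resolution M n) N -> linhom (resolution M n.+1) N :=
  precomp (@res_diff M n).

HB.instance Definition _ (M N : lmodType R) (n : nat) :=
  GRing.Linear.on (@codiff M N n).

(* Ext^n_R(M, N), the n-th cohomology of Hom_R(resolution M, N). *)
Definition Ext (n : nat) (M N : lmodType R) : lmodType R :=
  match n with
  | 0 => homology (\0 : {linear linhom (resolution M 0) N -> _}) (@codiff M N 0)
  | n.+1 => homology (@codiff M N n) (@codiff M N n.+1)
  end.

End Ext.

(** * Cohen-Macaulay type *)

Section LocalType.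
Variable R : comNzRingType.

(* dim_k E = n, for k = R / m and an R-module E killed by m: the R-linear maps
   between such modules are the k-linear ones, and E is isomorphic to k^n. *)
Definition residue_dim (m : idealr R) (E : lmodType R) (n : nat) : Prop :=
  exists f : {linear {ffun 'I_n -> residue m} -> E}, bijective f.

(* t(R) = n for a local ring R. The formula is the Cohen-Macaulay type when R is
   Cohen-Macaulay; this property is not part of the definition. *)
Definition local_cm_type (n : nat) : Prop :=
  exists (m : idealr R) (d : nat),
    [/\ local_ring m, krull_dim R d & residue_dim m (Ext d (residue m) R^o) n].

End LocalType.

(* t(R) = n: the maximum of t(R_p) over the maximal ideals p is n. Maximal ideals
   are prime, so they are among the elements of [prime_idealr R]; they are
   maximal among all proper ideals. *)
Definition cm_type (R : comNzRingType) (n : nat) : Prop :=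
  (forall p : prime_idealr R, maximal_ideal p ->
     exists2 k, local_cm_type (localization p) k & (k <= n)%N) /\
  (exists2 p : prime_idealr R, maximal_ideal p & local_cm_type (localization p) n).

(* Main.v *)
Require Import Defs.
From HB Require Import structures.
From mathcomp Require Import all_boot all_algebra.
From mathcomp Require Import generic_quotient ring_quotient.
From mathcomp Require Import finmap.
From mathcomp Require Import boolp classical_sets cardinality.
From mathcomp Require Import freeg ring zify.

(** Let A be the localization of R = K[H] at a nonzero prime p, m its maximal
    ideal and x a nonzero element of p. As x is regular and kills k = A/m,
    Ext^1(k, A) is isomorphic to (xA : m)/xA; on the canonical resolution the
    isomorphism evaluates a map from the first syzygy of k at x * <<1>>. The ring
    A has dimension 1 because m is the radical of zA for every nonzero z in p:
    for y in p there is P <> 0 with P(y) in z t^c K[t], c the conductor of H, and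
    z t^c K[t] lies in zR; dividing P(y) by the largest possible power of y
    leaves an element outside p.

    If p contains all the monomials t^h with h > 0, take x = t^e with e large.
    Then (xA : m)/xA has the basis t^(e + f), with f in PF(H). Otherwise p
    omits some T with T K[t] in R, and xA = m for x = T g, where g generates the
    ideal of the q in K[t] with T q in p; the type is then 1, and PF(H) is not
    empty. *)

Set Implicit Arguments.
Unset Strict Implicit.
Unset Printing Implicit Defensive.

Import GRing.Theory.

Local Open Scope quotient_scope.
Local Open Scope ring_scope.

(** * Linear maps out of free covers and onto quotient modules *)

Section FreeCover.
Variables (R : comNzRingType) (M N : lmodType R).

Definition free_lift (f : M -> N) : free_cover M -> N := fglift f.

Lemma free_lift_linear (f : M -> N) : linear (free_lift f).
Proof.
have additive : zmod_morphism (free_lift f) := lift_is_additive f.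
pose Z := GRing.isZmodMorphism.Build _ _ (free_lift f) additive.
pose g : {additive free_cover M -> N} := HB.pack (free_lift f) Z.
move=> a x y; rewrite -[free_lift f]/(g : _ -> _) raddfD; congr (_ + _).
rewrite -[x in RHS]freeg_sumE [a *: x]/(fgscale a x) /fgscale.
rewrite !raddf_sum; apply: eq_bigr => z _.
by rewrite /= /free_lift !liftU scalerA.
Qed.

HB.instance Definition _ (f : M -> N) :=
  GRing.isLinear.Build R (free_cover M) N *:%R (free_lift f) (free_lift_linear f).

Lemma free_liftE (f : M -> N) (z : M) : free_lift f << z >> = f z.
Proof. by rewrite /free_lift liftU scale1r. Qed.

Lemma free_cover_ext (g h : {linear free_cover M -> N}) :
  (forall z : M, g << z >> = h << z >>) -> g =1 h.
Proof.
move=> gh x; rewrite -[x]freeg_sumE !linear_sum; apply: eq_bigr => z _.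
have -> : << coeff z x *g z >> = coeff z x *: (<< z >> : free_cover M).
  by apply/eqP/freeg_eqP => k; rewrite coeffZ !coeffU mul1r.
by rewrite !linearZ /= gh.
Qed.

Lemma free_aug_gen (z : M) : free_aug (<< z >> : free_cover M) = z.
Proof. by rewrite /free_aug liftU scale1r. Qed.

End FreeCover.

Section QuotientMap.
Variables (R : comNzRingType) (V : lmodType R) (W : {pred V}).
Variable Wsub : submod_closed W.

Lemma quotmod_pi_linear : linear (quotmod_pi Wsub).
Proof.
move=> a x y; rewrite [a *: quotmod_pi Wsub x]pi_quotmod_scale.
exact: (raddfD \pi_(Quotient.quot (submod_zmodClosed Wsub))).
Qed.

Lemma quotmod_pi_eq0 (v : V) : (quotmod_pi Wsub v == 0) = (v \in W).
Proof.
rewrite -[v \in W]/(v \in submod_zmodClosed Wsub) -[v in RHS]subr0.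
rewrite Quotient.idealrBE; congr (_ == _).
by rewrite (raddf0 \pi_(Quotient.quot (submod_zmodClosed Wsub))).
Qed.

Lemma quotmod_pi_surj (x : quotmod Wsub) : exists v, quotmod_pi Wsub v = x.
Proof. by exists (repr x); exact: reprK. Qed.

End QuotientMap.

(** * Ext^1 as the maps on the first syzygy modulo those that extend to the free cover *)

Section ExtOne.
Variables (R : comNzRingType) (M N : lmodType R).
Local Notation S := (syzygy 1 M).
Implicit Type g : linhom S N.

(** The differential F_2 -> F_1 takes values in the kernel of F_1 -> S, so the composite of F_1 -> S
    with g vanishes on them. *)
Fact cocycle_subproof g : precomp (@free_aug R S) g \in ker_pred (@codiff R M N 1).
Proof.
rewrite unfold_in; apply/eqP/val_inj/funext => y /=.
have -> : free_aug (res_diff y) = 0 :> S.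
  by rewrite /res_diff; case: (free_aug y) => z /= /eqP.
exact: linear0.
Qed.

(** Up to sign, the connecting map Hom(S, N) -> Ext^1(M, N) of 0 -> S -> F_0 -> M -> 0. *)
Definition ext1_class g : Ext 1 M N :=
  quotmod_pi (boundary_submod (@codiff R M N 0) (@codiff R M N 1))
    (KerMod (cocycle_subproof g)).

Lemma ext1_class_linear : linear ext1_class.
Proof.
move=> a g h; rewrite /ext1_class -quotmod_pi_linear.
by congr quotmod_pi; apply: val_inj => /=; rewrite linearP.
Qed.

HB.instance Definition _ :=
  GRing.isLinear.Build R (linhom S N) (Ext 1 M N) *:%R ext1_class
    ext1_class_linear.

(** Every s in S is the image of the generator [<< s >>] of F_1, so a cochain psi on F_0 whose
    coboundary is the cocycle of g agrees with g on all of S. *)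
Lemma ext1_class_eq0 g :
  ext1_class g = 0 <->
  exists psi : linhom (resolution M 0) N, forall s : S, psi (kerval s) = g s.
Proof.
split=> [/eqP|[psi psiE]].
  rewrite quotmod_pi_eq0 unfold_in => /asboolP[psi /(congr1 val) /= psiE].
  exists psi => s; have /(congr1 (@^~ (<< s >> : free_cover S))) /= := psiE.
  by rewrite /res_diff free_aug_gen.
apply/eqP; rewrite quotmod_pi_eq0 unfold_in; apply/asboolP; exists psi.
apply: val_inj; apply/funext => x /=; exact: psiE.
Qed.

(** A cocycle vanishes on the image of F_2, which by exactness is the kernel of F_1 -> S, so it
    factors through S. Its value at s is read off at the generator [<< s >>]. *)
Lemma ext1_class_surj (e : Ext 1 M N) : exists g, ext1_class g = e.
Proof.
have [[phi phi0] <-] := quotmod_pi_surj e.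
have factors u v : free_aug u = free_aug v :> S -> phi u = phi v.
  move=> uv; apply/eqP; rewrite -subr_eq0 -linearB; apply/eqP.
  have /res_diff_exact[w wE] : @res_diff R M 0 (u - v) = 0.
    have uv0 : free_aug (u - v) = 0 :> S by apply/eqP; rewrite linearB subr_eq0; apply/eqP.
    by rewrite /res_diff uv0.
  move: phi0; rewrite unfold_in => /eqP/(congr1 val)/(congr1 (@^~ w)) /=.
  by rewrite wE.
pose g (s : S) := phi << s >>.
have glin : g \in @hom_pred R S N.
  rewrite unfold_in; apply/asboolP => a x y.
  by rewrite /g -linearP; apply: factors; rewrite linearP /= !free_aug_gen.
exists (LinHom glin); congr quotmod_pi; apply: val_inj; apply: val_inj.
by apply/funext => x /=; apply: factors; rewrite free_aug_gen.
Qed.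

End ExtOne.

(** * Ext^1 of a residue ring, read off at a regular element of the ideal *)

Section ResidueExt.
Variables (A : comNzRingType) (m : idealr A).
Local Notation k := (residue m).

Definition residue_pi (a : A^o) : k := \pi_{ideal_quot m} a.

Lemma residue_pi_linear : linear residue_pi.
Proof.
move=> a x y; rewrite /residue_pi (rmorphD (\pi_{ideal_quot m})).
by rewrite (rmorphM (\pi_{ideal_quot m})).
Qed.

HB.instance Definition _ :=
  GRing.isLinear.Build A A^o k *:%R residue_pi residue_pi_linear.

Lemma residue_pi_eq0 a : (residue_pi a == 0) = (a \in m).
Proof.
rewrite -[a in RHS]subr0 Quotient.idealrBE; congr (_ == _).
by rewrite (raddf0 (\pi_{ideal_quot m})).
Qed.

Lemma residue_piK (z : k) : residue_pi (repr z) = z. Proof. exact: reprK. Qed.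

Lemma residue_pi1 : residue_pi 1 = 1.
Proof. exact: (rmorph1 (\pi_{ideal_quot m})). Qed.

Lemma residue_scale_eq0 a (z : k) : a \in m -> a *: z = 0.
Proof.
rewrite -residue_pi_eq0 => /eqP a0; rewrite -[z]residue_piK.
transitivity (repr z *: residue_pi a); last by rewrite a0 scaler0.
by rewrite -!linearZ; congr residue_pi; exact: mulrC.
Qed.

Local Notation S := (syzygy 1 (k : lmodType A)).
Local Notation F := (resolution (k : lmodType A) 0).
Local Notation e := (<< (1 : k) >> : F).

(** Because m kills k, multiplication by an element of m maps all of F into the syzygy. *)
Fact scale_ker_subproof a (am : a \in m) (u : F) : a *: u \in ker_pred (@free_aug A k).
Proof. by rewrite unfold_in linearZ /= residue_scale_eq0. Qed.

Definition scale_ker a (am : a \in m) (u : F) : S := KerMod (scale_ker_subproof am u).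

Lemma scale_ker_linear a (am : a \in m) : linear (scale_ker am).
Proof.
by move=> b u v; apply: val_inj; rewrite /= scalerDr !scalerA mulrC.
Qed.

HB.instance Definition _ a (am : a \in m) :=
  GRing.isLinear.Build A F S *:%R (scale_ker am) (scale_ker_linear am).

(** In k, z is [repr z] times 1. These differences show that F is the sum of S and A e, which is how
    maps on S get extended to F. *)
Fact gen_diff_subproof (z : k) :
  << z >> - repr z *: e \in ker_pred (@free_aug A k).
Proof.
rewrite unfold_in linearB linearZ /= !free_aug_gen subr_eq0 eq_sym.
by rewrite -residue_pi1 -linearZ /= [_ *: _]mulr1 residue_piK.
Qed.

Definition gen_diff (z : k) : S := KerMod (gen_diff_subproof z).

(** F is free, so the augmentation F -> k lifts through A -> k; the lift carries S into m. *)
Definition residue_lift : {linear F -> A^o} := free_lift (fun z : k => repr z : A^o).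

Lemma residue_liftK (u : F) : residue_pi (residue_lift u) = free_aug u.
Proof.
apply: (free_cover_ext (g := residue_pi \o residue_lift)) => z.
by rewrite /= free_liftE free_aug_gen residue_piK.
Qed.

Lemma residue_lift_ker (s : S) : residue_lift (kerval s) \in m.
Proof. by rewrite -residue_pi_eq0 residue_liftK; case: s. Qed.

Variables (x : A) (xm : x \in m).
Hypothesis x_reg : forall y, x * y = 0 -> y = 0.
Implicit Type g : linhom S A^o.
Local Notation xe := (scale_ker xm e).

Let xI y z : x * y = x * z -> y = z.
Proof.
by move=> /eqP; rewrite -subr_eq0 -mulrBr => /eqP/x_reg/subr0_eq.
Qed.

(** An extension psi gives g(x e) = x psi(e). Conversely, an extension must send [<< z >>] to
    [g (gen_diff z) + repr z * b]; x times this map is g composed with multiplication by x, and x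
    can be cancelled. *)
Lemma ext1_residue_eq0 g : ext1_class g = 0 <-> exists b, g xe = x * b.
Proof.
rewrite ext1_class_eq0; split=> [[psi psiE]|[b bE]].
  by exists (psi e); rewrite -psiE /= linearZ.
pose f (z : k) : A^o := g (gen_diff z) + repr z * b.
have psi_lin : (free_lift f : F -> A^o) \in @hom_pred A F A^o.
  rewrite unfold_in; apply/asboolP; exact: linearP.
exists (LinHom psi_lin) => s /=; apply: xI.
have scaleE : x \*: free_lift f =1 g \o scale_ker xm.
  apply: free_cover_ext => z /=.
  rewrite free_liftE /f scalerDr -linearZ.
  have -> : x *: (repr z * b : A^o) = g (repr z *: xe).
    transitivity (repr z *: g xe); last by rewrite linearZ.
    by rewrite bE; exact: mulrCA.
  rewrite -linearD; congr (g _); apply: val_inj => /=.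
  by rewrite scalerBr !scalerA mulrC subrK.
rewrite -[LHS]/((x \*: free_lift f) (kerval s)) scaleE /=.
transitivity (g (x *: s)); last by rewrite linearZ.
by congr (g _); apply: val_inj.
Qed.

(** Both x e and y e lie in S, and y g(x e) = g(x y e) = x g(y e). *)
Lemma ext1_residue_colon g y : y \in m -> exists b, y * g xe = x * b.
Proof.
move=> ym; exists (g (scale_ker ym e)).
transitivity (g (y *: xe)); first by rewrite linearZ.
transitivity (g (x *: scale_ker ym e)); last by rewrite linearZ.
by congr (g _); apply: val_inj; rewrite /= !scalerA mulrC.
Qed.

(** The map g multiplies the lift of s by a and divides by x: the quotient exists because the lift
    of s lies in m, and it is unique because x is regular. *)
Lemma ext1_residue_exists a :
  (forall y, y \in m -> exists b, y * a = x * b) ->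
  exists g b, g xe = a + x * b.
Proof.
move=> colon.
have /choice[q qE] : forall s : S, exists w, residue_lift (kerval s) * a = x * w.
  by move=> s; apply: colon; exact: residue_lift_ker.
have qlin : (q : S -> A^o) \in @hom_pred A S A^o.
  rewrite unfold_in; apply/asboolP => c s t; apply: xI.
  rewrite -qE; transitivity (c * (residue_lift (kerval s) * a) + residue_lift (kerval t) * a).
    by rewrite /= linearP mulrDl mulrA.
  by rewrite !qE mulrCA -mulrDr.
exists (LinHom qlin).
(* The lift of e is a representative of 1 in A/m and may differ from 1 by an element of m; this
   produces the term [x * b]. *)
have [|b bE] := colon (residue_lift e - 1).
  rewrite -residue_pi_eq0 linearB /= residue_liftK free_aug_gen.
  by rewrite residue_pi1 subrr.
exists b; rewrite -bE mulrBl mul1r addrC subrK; apply: xI; rewrite /= -qE /=.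
by rewrite linearZ -mulrA.
Qed.

End ResidueExt.

(** * A basis of Ext^1(k, A) from a basis of (xA : m)/xA *)

Section HomEval.
Variables (R : comNzRingType) (U V : lmodType R) (u : U).

Definition hom_eval (f : linhom U V) : V := f u.

Lemma hom_eval_linear : linear hom_eval. Proof. by []. Qed.

HB.instance Definition _ :=
  GRing.isLinear.Build R (linhom U V) V *:%R hom_eval hom_eval_linear.

End HomEval.

Section ResidueDim.
Variables (A : comNzRingType) (m : idealr A) (x : A).
Hypotheses (xm : x \in m) (x_reg : forall y, x * y = 0 -> y = 0).
Local Notation k := (residue m).

Lemma ext1_scale_eq0 c (E : Ext 1 k A^o) : c \in m -> c *: E = 0.
Proof.
have [g <-] := ext1_class_surj E; move=> cm; rewrite -linearZ.
by apply/(ext1_residue_eq0 xm x_reg); exact: ext1_residue_colon.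
Qed.

(** Since m kills Ext^1, the choice of representatives does not matter; coordinates in k can act
    through [repr]. *)
Lemma ext1_scale_repr c (E : Ext 1 k A^o) : repr (residue_pi m c) *: E = c *: E.
Proof.
apply/eqP; rewrite -subr_eq0 -scalerBl; apply/eqP/ext1_scale_eq0.
by rewrite -residue_pi_eq0 linearB /= residue_piK subrr.
Qed.

(* [(xA : m) / xA] is Hom(k, A/xA), which is isomorphic to Ext^1(k, A) because x
   is a regular element that kills k. *)
Lemma ext1_residue_dim n (a : 'I_n -> A) :
  (forall i y, y \in m -> exists b, y * a i = x * b) ->
  (forall a', (forall y, y \in m -> exists b, y * a' = x * b) ->
     exists c b, a' = \sum_i c i * a i + x * b) ->
  (forall c b, \sum_i c i * a i = x * b -> forall i, c i \in m) ->
  residue_dim m (Ext 1 k A^o) n.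
Proof.
move=> socle gen free.
pose xe := scale_ker xm (<< (1 : k) >> : resolution (k : lmodType A) 0).
have /choice[g] : forall i, exists g : linhom (syzygy 1 k) A^o,
    exists b, g xe = a i + x * b.
  by move=> i; exact: (ext1_residue_exists xm x_reg (socle i)).
move=> /choice[b gE].
have gsumE (c : 'I_n -> A) :
    hom_eval xe (\sum_i c i *: g i) = \sum_i c i * a i + x * \sum_i c i * b i.
  rewrite linear_sum mulr_sumr -big_split; apply: eq_bigr => i _ /=.
  rewrite -[LHS]/(c i *: g i xe) gE scalerDr.
  by congr (_ + _); exact: mulrCA.
pose f (v : {ffun 'I_n -> k}) : Ext 1 k A^o :=
  \sum_i repr (v i) *: ext1_class (g i).
have f_lin : linear f.
  move=> c v w; rewrite /f scaler_sumr -big_split; apply: eq_bigr => i _ /=.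
  rewrite scalerA -scalerDl -[RHS]ext1_scale_repr; congr (repr _ *: _).
  by rewrite !ffunE -[v i in LHS]residue_piK -[w i in LHS]residue_piK -linearP.
have f_class (c : 'I_n -> A) :
    f [ffun i => residue_pi m (c i)] = ext1_class (\sum_i c i *: g i).
  rewrite /f [RHS]linear_sum; apply: eq_bigr => i _.
  by rewrite ffunE ext1_scale_repr [RHS]linearZ.
have f_pi (v : {ffun 'I_n -> k}) : v = [ffun i => residue_pi m (repr (v i))].
  by apply/ffunP => i; rewrite ffunE residue_piK.
pose flin : {linear {ffun 'I_n -> k} -> Ext 1 k A^o} :=
  HB.pack f (GRing.isLinear.Build A {ffun 'I_n -> k} (Ext 1 k A^o) *:%R f f_lin).
have f_inj : injective f.
  apply: (raddf_inj (f := flin)) => v /=; rewrite [v in f v]f_pi f_class.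
  (* If a combination of the [g i] has class zero, its value at [xe] lies in xA, hence so does the
     same combination of the [a i], and all coefficients lie in m. *)
  case/(ext1_residue_eq0 xm x_reg) => y; rewrite -[LHS]/(hom_eval xe _) gsumE.
  move=> /(canRL (addrK _)); rewrite -mulrBr => /free cm.
  by apply/ffunP => i; rewrite ffunE -[v i]residue_piK; apply/eqP; rewrite residue_pi_eq0.
have f_surj E : exists v, f v = E.
  have [h <-] := ext1_class_surj E.
  have [y /(ext1_residue_colon xm) //|c [y hE]] := gen (h xe).
  exists [ffun i => residue_pi m (c i)]; rewrite f_class.
  apply/eqP; rewrite -subr_eq0 -linearB; apply/eqP/(ext1_residue_eq0 xm x_reg).
  exists (\sum_i c i * b i - y); rewrite -[LHS]/(hom_eval xe _) linearB /=.
  by rewrite gsumE -[hom_eval xe h]/(h xe) hE mulrBr opprD addrACA subrr add0r.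
have [h hE] := choice f_surj.
exists flin; exists h => [v|E]; last exact: hE.
by apply: f_inj; rewrite hE.
Qed.

End ResidueDim.

(** * Localization of a domain at a prime ideal *)

Definition prime_ideal_of (R : comNzRingType) (S : {pred R})
    (Si : idealr_closed S) (Sp : prime_idealr_closed S) : prime_idealr R :=
  HB.pack_for (prime_idealr R) (S : R -> bool)
    (isIdealr.Build R S Si) (isPrimeIdealrClosed.Build R S Sp).

Lemma prime_idealX (R : comNzRingType) (p : prime_idealr R) y n :
  y ^+ n \in p -> y \in p.
Proof.
elim: n => [|n IHn]; first by rewrite expr0 idealr1.
by rewrite exprS prime_idealrM => /orP[].
Qed.

Lemma notin_primeX (R : comNzRingType) (p : prime_idealr R) y n :
  y \notin p -> y ^+ n \notin p.
Proof. by apply: contra; exact: prime_idealX. Qed.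

Section LocalizationTheory.
Variables (R : comNzRingType) (p : prime_idealr R).
Local Notation L := (localization p).

Definition loc_inj (a : R) : L := \pi_L (Frac a (notin_prime1 p)).

Lemma loc_inj_zmod : zmod_morphism loc_inj.
Proof.
move=> a b; rewrite /loc_inj.
rewrite -[RHS]/(loc_add _ (loc_opp _)) !piE.
by apply: frac_same => /=; ring.
Qed.

Lemma loc_inj_monoid : monoid_morphism loc_inj.
Proof.
split=> // a b; rewrite /loc_inj -[RHS]/(loc_mul _ _) !piE.
by apply: frac_same => /=; ring.
Qed.

HB.instance Definition _ := GRing.isZmodMorphism.Build R L loc_inj loc_inj_zmod.
HB.instance Definition _ :=
  GRing.isMonoidMorphism.Build R L loc_inj loc_inj_monoid.

Lemma loc_inj_unit s : s \notin p -> exists w, w * loc_inj s = 1.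
Proof.
move=> sp; exists (\pi_L (Frac 1 sp)).
rewrite -[LHS]/(loc_mul _ _) -[RHS]/(loc1 p) /loc1 /loc_inj !piE.
by apply: frac_same => /=; ring.
Qed.

Lemma loc_fraction (z : L) :
  exists s a, s \notin p /\ loc_inj s * z = loc_inj a.
Proof.
elim/quotW: z => -[a s sp]; exists s, a; split=> //.
rewrite -[LHS]/(loc_mul _ _) /loc_inj !piE.
by apply: frac_same => /=; ring.
Qed.

(** The product of all denominators is a common one; each numerator is multiplied by the
    denominators of the others. *)
Lemma loc_fractions (I : finType) (c : I -> L) :
  exists (s : R) (a : I -> R), s \notin p /\ forall i, loc_inj s * c i = loc_inj (a i).
Proof.
have /choice[s /choice[a saE]] := fun i => loc_fraction (c i).
exists (\prod_i s i), (fun i => (\prod_(j | j != i) s j) * a i); split=> [|i].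
  by elim/big_ind: _ => [|*|i _]; [exact: notin_prime1|exact: notin_primeM|case: (saE i)].
by rewrite (bigD1 i) //= !rmorphM /= -(saE i).2; ring.
Qed.

Hypothesis R_dom : forall u v : R, u * v = 0 -> u = 0 \/ v = 0.

Lemma loc_inj_eq0 a : loc_inj a = 0 -> a = 0.
Proof.
move=> a0; have /eqP/fracP[u up /=] : loc_inj a = loc0 p := a0.
rewrite mulr1 mul0r subr0 => /R_dom[u0|//].
by rewrite u0 rpred0 in up.
Qed.

Lemma loc_inj_inj : injective loc_inj.
Proof. by apply: raddf_inj => a; exact: loc_inj_eq0. Qed.

Lemma loc_injI s (y z : L) : s \notin p -> loc_inj s * y = loc_inj s * z -> y = z.
Proof.
case/loc_inj_unit=> w ws E; rewrite -[y]mul1r -[z]mul1r -ws.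
by rewrite -!mulrA E.
Qed.

Lemma loc_dom (y z : L) : y * z = 0 -> y = 0 \/ z = 0.
Proof.
have [s [a [sp aE]]] := loc_fraction y; have [t [b [tp bE]]] := loc_fraction z.
move=> yz; have : loc_inj (a * b) = 0.
  by rewrite rmorphM /= -aE -bE mulrACA yz mulr0.
move=> /loc_inj_eq0/R_dom[a0|b0]; [left|right].
  by apply: (loc_injI sp); rewrite aE a0 rmorph0 mulr0.
by apply: (loc_injI tp); rewrite bE b0 rmorph0 mulr0.
Qed.

Definition loc_max_pred : {pred L} := fun z =>
  `[< exists s a, [/\ s \notin p, a \in p & loc_inj s * z = loc_inj a] >].

(** Two fractions for z give t a = s b. As t is outside the prime p, membership in pR_p can be
    tested on any one fraction. *)
Lemma in_loc_max_pred s a z :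
  s \notin p -> loc_inj s * z = loc_inj a -> (z \in loc_max_pred) = (a \in p).
Proof.
move=> sp E; rewrite unfold_in; apply/asboolP/idP => [[t [b [tp bp E']]]|ap].
  suff: t * a \in p by rewrite prime_idealrM (negPf tp).
  have -> : t * a = s * b.
    by apply: loc_inj_inj; rewrite !rmorphM /= -E -E' mulrCA.
  exact: idealMr.
by exists s, a.
Qed.

Lemma loc_max_ideal : idealr_closed loc_max_pred.
Proof.
split.
- by rewrite (@in_loc_max_pred 1 0) ?rpred0 ?notin_prime1 ?mulr0 ?rmorph0.
- by rewrite (@in_loc_max_pred 1 1) ?idealr1 ?notin_prime1 ?mulr1.
move=> a u v; have [s [b [sp bE]]] := loc_fraction u.
have [t [c [tp cE]]] := loc_fraction v; have [r [d [rp dE]]] := loc_fraction a.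
rewrite (in_loc_max_pred sp bE) (in_loc_max_pred tp cE) => bp cp.
rewrite (@in_loc_max_pred (s * t * r) (t * (d * b) + s * r * c)).
- by apply: rpredD; do ?apply: idealMr.
- by rewrite !notin_primeM.
by rewrite rmorphD !rmorphM /= -bE -cE -dE; ring.
Qed.

Lemma loc_max_prime : prime_idealr_closed loc_max_pred.
Proof.
move=> u v; have [s [b [sp bE]]] := loc_fraction u.
have [t [c [tp cE]]] := loc_fraction v.
rewrite (in_loc_max_pred sp bE) (in_loc_max_pred tp cE).
rewrite (@in_loc_max_pred (s * t) (b * c)) ?prime_idealrM ?negb_or ?sp //.
by rewrite !rmorphM /= -bE -cE mulrACA.
Qed.

Definition loc_max : prime_idealr L := prime_ideal_of loc_max_ideal loc_max_prime.

Lemma in_loc_max s a z :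
  s \notin p -> loc_inj s * z = loc_inj a -> (z \in loc_max) = (a \in p).
Proof. exact: in_loc_max_pred. Qed.

Lemma loc_inj_max a : (loc_inj a \in loc_max) = (a \in p).
Proof. by rewrite (@in_loc_max 1 a) ?notin_prime1 // rmorph1 mul1r. Qed.

Lemma loc_max_unit z : z \notin loc_max -> exists w, w * z = 1.
Proof.
have [s [a [sp aE]]] := loc_fraction z; rewrite (in_loc_max sp aE).
by case/loc_inj_unit => w wE; exists (w * loc_inj s); rewrite -mulrA aE.
Qed.

(** Elements outside [loc_max] are units, and members of [idealr L] are proper. *)
Lemma proper_sub_loc_max (I : idealr L) : {subset I <= loc_max}.
Proof.
move=> z zI; apply: contraT => /loc_max_unit[w wz].
by rewrite -(idealr1 I) -wz idealMr.
Qed.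

Lemma loc_local : local_ring loc_max.
Proof.
split=> [I _|I Imax]; first exact: proper_sub_loc_max.
by move=> z; apply/idP/idP; [exact: proper_sub_loc_max|apply: Imax; exact: proper_sub_loc_max].
Qed.

Lemma loc_zero_ideal : idealr_closed (pred1 (0 : L)).
Proof.
split=> [||a u v /eqP-> /eqP->].
- exact: (eqxx (0 : L)).
- exact: (oner_neq0 L).
by rewrite mulr0 addr0; exact: (eqxx (0 : L)).
Qed.

Lemma loc_zero_prime : prime_idealr_closed (pred1 (0 : L)).
Proof.
by move=> u v /eqP/loc_dom[u0|v0]; apply/orP; [left|right]; exact/eqP.
Qed.

Variable x : R.
Hypotheses (xp : x \in p) (x_neq0 : x <> 0).
Hypothesis p_radical : forall z y, z <> 0 -> y \in p ->
  exists n s r, s \notin p /\ s * y ^+ n = z * r.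

(** The zero ideal and pR_p form a chain of length 1. In a chain P0 < P1 < P2 the ideal P1 contains
    some z <> 0; by [p_radical] each y in P2 has a power in zL, so y lies in P1, a contradiction. *)
Lemma loc_krull_dim : krull_dim L 1.
Proof.
split=> [|n [P Pchain]].
  exists (fun i : 'I_2 => if i == 0 :> nat
    then prime_ideal_of loc_zero_ideal loc_zero_prime else loc_max).
  move=> [[|[|//]] ?] [[|[|//]] ?] //= _; split.
    by move=> z; move=> /eqP->; exact: (rpred0 loc_max).
  move=> /(_ (loc_inj x)); rewrite loc_inj_max xp inE => /(_ isT)/eqP.
  by move/loc_inj_eq0.
rewrite leqNgt; apply/negP => n_gt1.
have [n1 n2] : (1 < n.+1 /\ 2 < n.+1)%N by lia.
have [P01 P10] := Pchain ord0 (Ordinal n1) isT.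
have [P12 P21] := Pchain (Ordinal n1) (Ordinal n2) isT.
apply: P21 => y yP2.
have [z zP1 z_neq0] : exists2 z, z \in P (Ordinal n1) & z <> 0.
  apply: contrapT => nz; apply: P10 => z zP1.
  have [->|/eqP z0] := eqVneq z 0; first exact: rpred0.
  by case: nz; exists z.
have /proper_sub_loc_max := yP2.
have [s [a [sp aE]]] := loc_fraction y; rewrite (in_loc_max sp aE) => ap.
have [t [b [tp bE]]] := loc_fraction z.
have b_neq0 : b <> 0.
  by move=> b0; apply: z_neq0; apply: (loc_injI tp); rewrite bE b0 rmorph0 mulr0.
have [k [u [r [up uE]]]] := p_radical b_neq0 ap.
have uskP : loc_inj (u * s ^+ k) * y ^+ k \in P (Ordinal n1).
  rewrite rmorphM rmorphXn -mulrA -exprMn /= aE -rmorphXn -rmorphM uE.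
  by rewrite rmorphM /= -bE mulrAC idealMr.
apply: (prime_idealX (n := k)).
have [w wE] := loc_inj_unit (notin_primeM up (notin_primeX k sp)).
by rewrite -[_ ^+ k]mul1r -wE -mulrA idealMr.
Qed.

(** The conditions for a basis of (xA : m)/xA are brought down to R by clearing denominators, whence
    the factors s outside p. *)
Lemma loc_cm_type n (a : 'I_n -> R) :
  (forall i y, y \in p -> exists s r, s \notin p /\ s * (y * a i) = x * r) ->
  (forall b, (forall y, y \in p -> exists s r, s \notin p /\ s * (y * b) = x * r) ->
    exists s c r, s \notin p /\ s * b = \sum_i c i * a i + x * r) ->
  (forall c r, \sum_i c i * a i = x * r -> forall i, c i \in p) ->
  local_cm_type L n.
Proof.
move=> socle gen free; exists loc_max, 1%N; split; [exact: loc_local|exact: loc_krull_dim|].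
have xm : loc_inj x \in loc_max by rewrite loc_inj_max.
apply: (@ext1_residue_dim _ _ _ xm _ n (loc_inj \o a)).
- by move=> y /loc_dom[/loc_inj_eq0|].
- move=> i y; have [s [b [sp bE]]] := loc_fraction y; rewrite (in_loc_max sp bE) => bp.
  have [t [r [tp tE]]] := socle i b bp.
  have [w wE] := loc_inj_unit (notin_primeM sp tp).
  exists (w * loc_inj r); rewrite mulrCA -rmorphM -tE !rmorphM /= -bE.
  rewrite -[LHS]mul1r -wE rmorphM /=; ring.
- move=> z z_socle; have [s [b [sp bE]]] := loc_fraction z.
  have [y yp|t [c [r [tp tE]]]] := gen b.
    have [|w wE] := z_socle (loc_inj y); first by rewrite loc_inj_max.
    have [t [d [tp dE]]] := loc_fraction w.
    exists t, (s * d); split=> //; apply: loc_inj_inj.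
    rewrite !rmorphM /= -bE -dE.
    transitivity (loc_inj t * loc_inj s * (loc_inj y * z)); first ring.
    by rewrite wE; ring.
  have [w wE] := loc_inj_unit (notin_primeM sp tp).
  exists (fun i => w * loc_inj (c i)), (w * loc_inj r).
  transitivity (w * loc_inj (t * b)).
    by rewrite rmorphM /= -bE -[LHS]mul1r -wE rmorphM /=; ring.
  rewrite tE rmorphD rmorph_sum mulrDr mulr_sumr rmorphM /= [in RHS]mulrCA.
  by congr (_ + _); apply: eq_bigr => i _; rewrite rmorphM mulrA.
move=> c b bE i.
(* The index [None] stands for b, so that b and all [c i] get one common denominator. *)
pose d (o : option 'I_n) := if o is Some j then c j else b.
have [s [e [sp eE]]] := loc_fractions d.
rewrite (in_loc_max sp (eE (Some i))).
apply: (free (fun j => e (Some j)) (e None)); apply: loc_inj_inj.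
rewrite rmorph_sum rmorphM /= -(eE None) mulrCA -bE mulr_sumr.
by apply: eq_bigr => j _; rewrite rmorphM /= -(eE (Some j)) mulrA.
Qed.

End LocalizationTheory.

(** * Algebraic dependence modulo a polynomial *)

Section CompPoly.
Variable K : fieldType.

(** With n the size of g, the n + 1 remainders of 1, y, ..., y^n modulo g lie in a space of
    dimension n; a linear dependence among them gives the coefficients of P. *)
Lemma comp_poly_dvd (g y : {poly K}) : g != 0 -> exists2 P, P != 0 & g %| P \Po y.
Proof.
move=> g_neq0; set n := size g.
pose M : 'M[K]_(n.+1, n) := \matrix_i poly_rV (y ^+ i %% g).
have : kermx M != 0.
  by rewrite kermx_eq0 /row_free neq_ltn ltnS rank_leq_col.
case/rowV0Pn => v /sub_kermxP vM v_neq0; exists (rVpoly v).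
  by apply: contra v_neq0 => /eqP v0; rewrite -[v]rVpolyK v0 linear0.
have vE : rVpoly v = \sum_i v 0 i *: 'X^i.
  rewrite [in LHS](row_sum_delta v) linear_sum; apply: eq_bigr => i _.
  by rewrite linearZ /= rVpoly_delta.
rewrite /dvdp vE linear_sum /= (big_morph _ (modpD g) (mod0p g)); apply/eqP.
transitivity (rVpoly (v *m M)); last by rewrite vM linear0.
rewrite mulmx_sum_row linear_sum; apply: eq_bigr => i _.
rewrite comp_polyZ comp_Xn_poly modpZl linearZ rowK /= poly_rV_K //.
by rewrite -ltnS (leq_trans (ltn_modpN0 _ g_neq0)).
Qed.

End CompPoly.

(** * Supports, conductor and radicals in the semigroup ring *)

Section SemigroupRingTheory.
Variables (K : fieldType) (H : set nat).
Hypothesis hH : numerical_semigroup H.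
Local Notation R := (semigroup_ring K H).

(** The polynomials supported in H form a subalgebra that contains the generating monomials;
    conversely each of them is a combination of these monomials. *)
Lemma sgring_predP (q : {poly K}) :
  q \in sgring_pred H <-> forall i, q`_i != 0 -> H i.
Proof.
split=> [|qH].
  rewrite unfold_in => /asboolP.
  pose S : {pred {poly K}} := fun q => `[< forall i, q`_i != 0 -> H i >].
  move=> /(_ S) qS; suff : q \in S by rewrite unfold_in => /asboolP.
  apply: qS => [|h Hh]; last first.
    rewrite unfold_in; apply/asboolP => i; rewrite coefXn.
    by have [->|] := eqVneq i h; rewrite // eqxx.
  split=> [|a u v|u v]; rewrite !unfold_in.
  - by apply/asboolP => -[|i]; rewrite coef1 ?eqxx // => _; exact: nsg0.
  - move=> /asboolP uH /asboolP vH; apply/asboolP => i.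
    rewrite coefD coefZ; have [v0|/vH//] := eqVneq v`_i 0.
    by rewrite v0 addr0 mulf_eq0 negb_or => /andP[_ /uH].
  - move=> /asboolP uH /asboolP vH; apply/asboolP => i.
    rewrite coefM; apply: contra_neqP => nHi; apply: big1 => j _.
    apply: contra_notP nHi => /eqP; rewrite mulf_eq0 negb_or => /andP[/uH Hj /vH].
    by move/(nsgD hH Hj); rewrite subnKC // -ltnS.
rewrite -[q]coefK poly_def; apply: rpred_sum => i _.
have [->|qi] := eqVneq q`_i 0; first by rewrite scale0r rpred0.
apply: rpredZ; rewrite unfold_in; apply/asboolP => S _; apply; exact: qH.
Qed.

(** The default 0 is taken when q is not in the ring; [sgrK] asks for the support condition that
    excludes it. *)
Definition sgr (q : {poly K}) : R := insubd 0 q.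

Lemma sgrK (q : {poly K}) : (forall i, q`_i != 0 -> H i) -> sgval (sgr q) = q.
Proof. by move/sgring_predP => qH; rewrite -[LHS]/(val _) insubdK. Qed.

Lemma sgval_supp (f : R) i : f`_i != 0 -> H i.
Proof. by have /sgring_predP := valP f; apply. Qed.

Lemma sgvalD (f g : R) : sgval (f + g) = sgval f + sgval g.
Proof. exact: (rmorphD (val : R -> {poly K})). Qed.
Lemma sgvalB (f g : R) : sgval (f - g) = sgval f - sgval g.
Proof. exact: (rmorphB (val : R -> {poly K})). Qed.
Lemma sgvalM (f g : R) : sgval (f * g) = sgval f * sgval g.
Proof. exact: (rmorphM (val : R -> {poly K})). Qed.
Lemma sgvalX (f : R) n : sgval (f ^+ n) = sgval f ^+ n.
Proof. exact: (rmorphXn (val : R -> {poly K})). Qed.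
Lemma sgval1 : sgval (1 : R) = 1. Proof. by []. Qed.
Lemma sgval_sum (I : finType) (f : I -> R) :
  sgval (\sum_i f i) = \sum_i sgval (f i).
Proof. exact: (rmorph_sum (val : R -> {poly K})). Qed.
Lemma sgval_inj : injective (@sgval K H). Proof. exact: val_inj. Qed.

Lemma sgring_dom (f g : R) : f * g = 0 -> f = 0 \/ g = 0.
Proof.
move=> /(congr1 (@sgval K H))/eqP; rewrite sgvalM mulf_eq0.
by move=> /orP[]/eqP; [left|right]; apply: sgval_inj.
Qed.

Definition sgC (a : K) : R := sgr a%:P.

Lemma sgCE a : sgval (sgC a) = a%:P.
Proof.
by apply: sgrK => -[|i]; rewrite coefC ?eqxx // => _; exact: nsg0.
Qed.

Lemma sgC_notin (p : idealr R) a : a != 0 -> sgC a \notin p.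
Proof.
move=> a0; apply: contraFN (idealr1 p) => ap.
have -> : 1 = sgC a^-1 * sgC a.
  by apply: sgval_inj; rewrite sgvalM !sgCE -polyCM mulVf.
exact: idealMr.
Qed.

Definition sgX (h : nat) : R := sgr 'X^h.

Lemma sgXE h : H h -> sgval (sgX h) = 'X^h.
Proof.
move=> Hh; apply: sgrK => i; rewrite coefXn.
by have [->|] := eqVneq i h; rewrite ?eqxx.
Qed.

(** Minimality is recorded through [n.+1 = c], without truncated subtraction, so it is vacuous when
    c = 0. *)
Lemma conductor :
  exists c, (forall n, (c <= n)%N -> H n) /\ (forall n, n.+1 = c -> ~ H n).
Proof.
have [c0 c0H] : exists c, forall n, (c <= n)%N -> H n.
  pose s := fset_set (~` H); exists (\max_(i <- s) i)%N.+1 => n.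
  apply: contraPP => nH; apply/negP; rewrite -ltnNge ltnS.
  have ns : n \in s by rewrite in_fset_set ?inE //; exact: nsg_cofinite.
  exact: (@leq_bigmax_seq nat (enum_fset s) xpredT id n ns isT).
pose Q c := `[< forall n, (c <= n)%N -> H n >].
have exQ : exists c, Q c by exists c0; exact/asboolP.
case: (ex_minnP exQ) => c /asboolP cH cmin; exists c; split=> // n nc Hn.
have /cmin : Q n; last by rewrite -nc ltnn.
apply/asboolP => k; rewrite leq_eqVlt nc => /predU1P[<-//|]; exact: cH.
Qed.

Lemma sgr_conductor c (q : {poly K}) : (forall n, (c <= n)%N -> H n) ->
  sgval (sgr ('X^c * q)) = 'X^c * q.
Proof.
move=> cH; apply: sgrK => i; rewrite coefXnM; case: ltnP => [|/cH//].
by rewrite eqxx.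
Qed.

Lemma sgring_radical (p : prime_idealr R) (z y : R) : z <> 0 -> y \in p ->
  exists n s r, s \notin p /\ s * y ^+ n = z * r.
Proof.
move=> z_neq0 yp; have [c [cH _]] := conductor.
have [|P P_neq0 /dvdpP[q Pq]] := @comp_poly_dvd K (sgval z * 'X^c) (sgval y).
  apply: mulf_neq0; last by rewrite -size_poly_eq0 size_polyXn.
  by apply: contra_notN z_neq0 => /eqP z0; apply: sgval_inj.
(* Here P = X^n Q with Q(0) <> 0, so P(y) = Q(y) y^n. *)
have [n [Q /implyP/(_ P_neq0) Q0 PE]] := multiplicity_XsubC P 0.
have compH (u : {poly K}) : sgval (sgr (u \Po sgval y)) = u \Po sgval y.
  apply: sgrK; apply/sgring_predP; rewrite comp_polyE.
  apply: rpred_sum => i _; apply: rpredZ; apply: rpredX; exact: valP.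
exists n, (sgr (Q \Po sgval y)), (sgr ('X^c * q)); split; last first.
  apply: sgval_inj; rewrite !sgvalM sgvalX compH sgr_conductor //.
  transitivity (P \Po sgval y); last by rewrite Pq; ring.
  by rewrite PE comp_polyM subr0 comp_Xn_poly.
(* Modulo yR, which lies in p, Q(y) is the nonzero constant Q(0), so it is outside p. *)
have QE : sgr (Q \Po sgval y) =
    sgC Q.[0] + y * sgr ((Q %/ 'X) \Po sgval y).
  apply: sgval_inj; rewrite sgvalD sgvalM !compH sgCE.
  rewrite [in LHS](divp_eq Q ('X - 0%:P)) modp_XsubC subr0.
  by rewrite comp_polyD comp_polyM comp_polyX comp_polyC addrC mulrC.
apply: contra (sgC_notin p Q0); rewrite QE => sp.
by rewrite -[sgC _](addrK (y * sgr ((Q %/ 'X) \Po sgval y))) rpredB // mulrC idealMr.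
Qed.

End SemigroupRingTheory.

(** * Enumeration of the pseudo-Frobenius numbers *)

Section PseudoFrobenius.
Variables (H : set nat).
Hypothesis hH : numerical_semigroup H.

Definition pf (i : 'I_(semigroup_type H)) : int :=
  nth 0 (enum_fset (fset_set (PF H))) i.

Lemma pf_in i : PF H (pf i).
Proof.
have : pf i \in enum_fset (fset_set (PF H)) by apply: mem_nth; exact: ltn_ord.
by rewrite [_ \in _]in_fset_set ?inE //; exact: PF_finite.
Qed.

Lemma pf_inj : injective pf.
Proof.
move=> i j /eqP; rewrite nth_uniq ?fset_uniq //; first by move/eqP/val_inj.
all: exact: ltn_ord.
Qed.

Lemma pf_surj z : PF H z -> exists i, pf i = z.
Proof.
move=> zPF; have zs : z \in enum_fset (fset_set (PF H)).
  by rewrite [_ \in _]in_fset_set ?inE //; exact: PF_finite.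
have zi : (index z (enum_fset (fset_set (PF H))) < semigroup_type H)%N.
  by rewrite index_mem.
by exists (Ordinal zi); rewrite /pf nth_index.
Qed.

(** The Frobenius number c - 1 is pseudo-Frobenius; it is -1 when H is all of N. *)
Lemma semigroup_type_gt0 : (0 < semigroup_type H)%N.
Proof.
have [c [cH cmin]] := conductor hH.
have [|i _] := @pf_surj (c%:Z - 1); last exact: leq_ltn_trans (ltn_ord i).
split=> [[n Hn nE]|h Hh h_gt0]; first by apply: (cmin n) => //; lia.
by exists (c + h - 1)%N; [apply: cH; lia|lia].
Qed.

End PseudoFrobenius.

(** * The type at a prime containing all positive monomials *)

Section MonomialType.
Variables (K : fieldType) (H : set nat).
Hypothesis hH : numerical_semigroup H.
Local Notation R := (semigroup_ring K H).
Local Notation sgX := (@sgX K H).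
Local Notation sgr := (@sgr K H).

(** An element with zero constant term is a combination of positive monomials, and a nonzero
    constant is a unit. *)
Lemma mem_coef0 (p : prime_idealr R) :
  (forall h, H h -> (0 < h)%N -> sgX h \in p) -> forall f, (f \in p) = ((sgval f)`_0 == 0).
Proof.
move=> pX f; have pX0 (g : R) : (sgval g)`_0 = 0 -> g \in p.
  move=> g0; have -> : g = \sum_(i < size (sgval g)) sgC H (sgval g)`_i * sgX i.
    apply: sgval_inj; rewrite sgval_sum -[LHS]coefK poly_def.
    apply: eq_bigr => i _; rewrite sgvalM sgCE // -mul_polyC.
    have [->|gi] := eqVneq (sgval g)`_i 0; first by rewrite polyC0 !mul0r.
    by rewrite sgXE //; exact: sgval_supp gi.
  apply: rpred_sum => i _; have [gi|gi] := eqVneq (sgval g)`_i 0.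
    have -> : sgC H (sgval g)`_i = 0 by apply: sgval_inj; rewrite sgCE // gi.
    by rewrite mul0r rpred0.
  apply: idealMr; apply: pX; first exact: sgval_supp gi.
  by rewrite lt0n; apply: contra_neq gi => ->.
apply/idP/eqP => [fp|/pX0//]; apply: contraTeq fp => f0.
apply: contra (sgC_notin hH p f0) => fp.
rewrite -[sgC _ _](subrK f) rpredD //; apply: pX0.
by rewrite sgvalB sgCE // coefB coefC subrr.
Qed.

Lemma sgX_dvdP e (q : R) : H e ->
  (exists r, q = sgX e * r) <->
  (forall j, (sgval q)`_j != 0 -> exists2 h, H h & j = (e + h)%N).
Proof.
move=> He; split=> [[r ->] j|qe].
  rewrite sgvalM sgXE // coefXnM; case: ltnP => [_|ej /(sgval_supp hH) Hj].
    by rewrite eqxx.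
  by exists (j - e)%N; rewrite ?subnKC.
exists (sgr (\poly_(i < size (sgval q)) (sgval q)`_(i + e))).
apply: sgval_inj; rewrite sgvalM sgXE // sgrK //.
  apply/polyP => j; rewrite coefXnM coef_poly; case: ltnP => [je|ej].
    by apply: contraTeq je => /qe[h _ ->]; rewrite -leqNgt leq_addr.
  rewrite subnK //; case: ltnP => // jq.
  by rewrite nth_default // (leq_trans jq) ?leq_subr.
move=> j; rewrite coef_poly; case: ifP => _; last by rewrite eqxx.
by move=> /qe[h Hh]; rewrite addnC => /addnI ->.
Qed.

Lemma monomial_type (p : prime_idealr R) :
  (forall h, H h -> (0 < h)%N -> sgX h \in p) ->
  local_cm_type (localization p) (semigroup_type H).
Proof.
move=> pX; have pE := mem_coef0 pX.
(* The successor makes c a positive element of H, to which the defining condition of PF(H)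
   applies. *)
have [c' [cH' _]] := conductor hH; pose c := c'.+1.
have cH n : (c <= n)%N -> H n by move=> cn; apply: cH'; lia.
(* For f in PF(H), f + c lies in H, so f >= -c and e + f >= c. Thus e + f is a natural number in H,
   and the absolute value in [m] changes nothing. *)
pose e := (c + c)%N; have He : H e by apply: cH; lia.
pose m (i : 'I_(semigroup_type H)) := `|(e%:Z + pf i)%R|%N.
have mE i : (m i)%:Z = e%:Z + pf i /\ (c <= m i)%N.
  have [_ /(_ c (cH c (leqnn c)) isT)[n _ nE]] := pf_in hH i.
  by rewrite /m; lia.
have m_inj : injective m.
  move=> i j mij; apply: (@pf_inj H); have [mi _] := mE i; have [mj _] := mE j.
  by lia.
have mH i : H (m i) by apply: cH; case: (mE i).
have pf_shift i h : H h -> (0 < h)%N -> exists2 g, H g & (m i + h = e + g)%N.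
  move=> Hh h_gt0; have [_ /(_ h Hh h_gt0)[g Hg gE]] := pf_in hH i.
  by exists g => //; have [mi _] := mE i; lia.
have pf_notin i g : H g -> m i <> (e + g)%N.
  by move=> Hg mg; have [+ _] := pf_in hH i; apply; exists g => //; have [] := mE i; lia.
(* Since s has a nonzero constant term, a term of q at j either survives in s q or is cancelled with
   the help of a term of q at some k < j; by induction k is in e + H, and j - k is in H. *)
have strip (s q : R) : s \notin p -> (exists r, s * q = sgX e * r) ->
    forall j, (sgval q)`_j != 0 -> exists2 h, H h & j = (e + h)%N.
  rewrite pE => s0 /(sgX_dvdP _ He) sqe; elim/ltn_ind => j IHj qj.
  have [sqj|/sqe//] := eqVneq (sgval (s * q))`_j 0.
  have [k [kj skj qk]] : exists k, [/\ (k < j)%N, (sgval s)`_(j - k) != 0 & (sgval q)`_k != 0].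
    apply: contrapT => nk; move/eqP: sqj; rewrite sgvalM coefMr big_ord_recr /= subnn.
    rewrite big1 ?add0r ?mulf_eq0 ?(negPf s0) ?(negPf qj) // => k _.
    apply/eqP; rewrite mulf_eq0; apply: contrapT => /negP; rewrite negb_or => /andP[? ?].
    by apply: nk; exists k; split.
  have [h Hh kE] := IHj k kj qk; exists (h + (j - k))%N; last by lia.
  by apply: nsgD => //; exact: sgval_supp skj.
apply: (@loc_cm_type R p (@sgring_dom K H) (sgX e) _ _ _ _ (fun i => sgX (m i))).
- by rewrite pE sgXE // coefXn; apply/eqP; case: eqP => //; lia.
- move/(congr1 (@sgval K H)); rewrite sgXE // => /(congr1 (fun q : {poly K} => q`_e)).
  by rewrite coefXn eqxx coef0 => /eqP; rewrite oner_eq0.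
- exact: sgring_radical.
- move=> i y; rewrite pE => /eqP y0.
  suff [r rE] : exists r, y * sgX (m i) = sgX e * r.
    by exists 1, r; rewrite mul1r notin_prime1.
  apply/(sgX_dvdP _ He) => j; rewrite sgvalM sgXE // coefMXn; case: ltnP => [_|mj yj].
    by rewrite eqxx.
  have [||g Hg gE] := pf_shift i (j - m i)%N; first exact: sgval_supp yj.
    by rewrite lt0n; apply: contra_neq yj => ->.
  by exists g => //; lia.
- move=> b b_socle.
  (* If k is not in e + H, then k - e is in PF(H): for h > 0 in H, t^h is in p, so t^h b lies in t^e
     R up to a factor outside p, and [strip] puts h + k in e + H. *)
  have bE k : (sgval b)`_k != 0 -> (exists2 h, H h & k = (e + h)%N) \/ exists i, k = m i.
    move=> bk; have [[h Hh ke]|nk] := pselect (exists2 h, H h & k = (e + h)%N).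
      by left; exists h.
    right; have [|i iE] := @pf_surj H hH (k%:Z - e%:Z); last first.
      by exists i; have [mi _] := mE i; lia.
    split=> [[h Hh hE]|h Hh h_gt0]; first by apply: nk; exists h => //; lia.
    have [s [r [sp sE]]] := b_socle _ (pX h Hh h_gt0).
    have [|g Hg gE] := strip s (sgX h * b) sp (ex_intro _ r sE) (h + k)%N.
      by rewrite sgvalM sgXE // coefXnM ltnNge leq_addr addKn.
    by exists g => //; lia.
  pose d := \sum_i sgC H (sgval b)`_(m i) * sgX (m i).
  suff [r rE] : exists r, b - d = sgX e * r.
    exists 1, (fun i => sgC H (sgval b)`_(m i)), r.
    by rewrite notin_prime1 mul1r -rE addrC subrK.
  have dE k : (sgval d)`_k = \sum_i (sgval b)`_(m i) * (k == m i)%:R.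
    rewrite sgval_sum coef_sum; apply: eq_bigr => i _.
    by rewrite sgvalM sgCE // sgXE // coefCM coefXn.
  apply/(sgX_dvdP _ He) => k.
  rewrite sgvalB coefB dE.
  have [[i ->]|nk] := pselect (exists i, k = m i).
    rewrite (bigD1 i) //= eqxx mulr1 big1 ?addr0 ?subrr ?eqxx // => j ji.
    by rewrite (inj_eq m_inj) eq_sym (negPf ji) mulr0.
  rewrite big1 ?subr0 => [/bE[//|/nk//]|j _].
  by case: eqP => [kj|_]; rewrite ?mulr0 //; case: nk; exists j.
move=> c0 r E i; rewrite pE; apply/eqP.
(* Compare coefficients at [m i]. The left side vanishes because [m i] is not in e + H. A term with
   j <> i would make [m i] the sum of [m j] and a positive element of H, hence an element of e + H.
   Only the constant term of [c0 i] remains. *)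
have cE : ('X^e * sgval r)`_(m i) = \sum_j (sgval (c0 j) * 'X^(m j))`_(m i).
  rewrite -(sgXE K hH He) -sgvalM -E sgval_sum coef_sum; apply: eq_bigr => j _.
  by rewrite sgvalM sgXE.
move: cE; rewrite (bigD1 i) //= coefMXn ltnn subnn.
rewrite big1 ?addr0 => [<-|j ji].
  rewrite coefXnM; case: ltnP => // em; apply: contrapT => /eqP/(sgval_supp hH)/pf_notin.
  by apply; rewrite subnKC.
rewrite coefMXn; case: ltnP => // mij; apply/eqP; apply: contraT => cj.
have [|g Hg gE] := pf_shift j _ (sgval_supp hH cj).
  by rewrite subn_gt0 ltn_neqAle mij (inj_eq m_inj) ji.
by case: (pf_notin i g Hg); rewrite -gE subnKC.
Qed.

End MonomialType.

(** * The type at a nonzero prime that omits a positive monomial *)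

Section NonMonomial.
Variables (K : fieldType) (H : set nat).
Hypothesis hH : numerical_semigroup H.
Local Notation R := (semigroup_ring K H).
Local Notation sgX := (@sgX K H).
Local Notation sgr := (@sgr K H).

Lemma non_monomial_type (p : prime_idealr R) (z : R) h : z \in p -> z <> 0 ->
  H h -> (0 < h)%N -> sgX h \notin p -> local_cm_type (localization p) 1.
Proof.
move=> zp z_neq0 Hh h_gt0 hp; have [c [cH _]] := conductor hH.
(* As a power of t^h, T stays outside the prime p; as h > 0, its exponent is at least c, so T K[t]
   lies in R. *)
pose T : {poly K} := 'X^(h * c).
have cT : (c <= h * c)%N by rewrite leq_pmull.
have TK q : sgval (sgr (T * q)) = T * q.
  by apply: sgr_conductor => // n hcn; apply: cH; exact: leq_trans hcn.
pose t := sgr (T * 1).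
have tp : t \notin p.
  have -> : t = sgX h ^+ c.
    by apply: sgval_inj; rewrite TK sgvalX sgXE // mulr1 -exprM.
  exact: notin_primeX.
have tE : sgval t = T by rewrite TK mulr1.
(* The polynomial g is a nonzero one of least size with T g in p; z shows that some exist. *)
pose Q n := `[< exists q, [/\ q != 0, sgr (T * q) \in p & size q = n] >].
have exQ : exists n, Q n.
  exists (size (sgval z)); apply/asboolP; exists (sgval z); split=> //.
    by apply: contra_notN z_neq0 => /eqP z0; exact: sgval_inj.
  have -> : sgr (T * sgval z) = t * z by apply: sgval_inj; rewrite TK sgvalM tE.
  exact: idealMr.
case: (ex_minnP exQ) => n /asboolP[g [g_neq0 gp gn]] gmin.
have g_dvd q : sgr (T * q) \in p -> g %| q.
  move=> qp; rewrite /dvdp; apply: contraT => r_neq0.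
  suff /gmin : Q (size (q %% g)) by rewrite -gn leqNgt ltn_modpN0.
  apply/asboolP; exists (q %% g); split=> //.
  (* The quotient of q by g need not lie in R. The extra factor t, which primality removes
     afterwards, turns it into an element of R. *)
  have : t * sgr (T * (q %% g)) \in p.
    have -> : t * sgr (T * (q %% g)) =
        t * sgr (T * q) - sgr (T * (q %/ g)) * sgr (T * g).
      apply: sgval_inj; rewrite sgvalB !sgvalM !TK.
      have -> : q %% g = q - q %/ g * g.
        by rewrite {2}(divp_eq q g) addrAC subrr add0r.
      ring.
    by rewrite rpredB // idealMr.
  by rewrite prime_idealrM (negPf tp).
apply: (@loc_cm_type R p (@sgring_dom K H) (sgr (T * g)) gp _ _ _ (fun=> 1)).
- move/(congr1 (@sgval K H)); rewrite TK => /eqP.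
  by rewrite mulf_eq0 (negPf g_neq0) orbF -size_poly_eq0 size_polyXn.
- exact: sgring_radical.
- move=> _ y yp.
  (* From y = q g follows T^2 y = (T q)(T g), so y is a multiple of T g in the localization. Hence 1
     spans (xA : m)/xA. *)
  have /g_dvd/dvdpP[q yE] : sgr (T * sgval y) \in p.
    have -> : sgr (T * sgval y) = t * y by apply: sgval_inj; rewrite TK sgvalM tE.
    exact: idealMr.
  exists (t * t), (sgr (T * q)); split; first by rewrite notin_primeM.
  by apply: sgval_inj; rewrite mulr1 !sgvalM !TK mulr1 yE; ring.
- move=> b _; exists 1, (fun=> b), 0.
  by rewrite notin_prime1 big_ord1 mulr1 mul1r mulr0 addr0.
move=> b r E i; move: E; rewrite big_ord1 mulr1 (ord1 i) => ->.
by rewrite mulrC idealMr.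
Qed.

End NonMonomial.

(** * The maximal ideal spanned by the positive monomials *)

Section MonomialIdeal.
Variables (K : fieldType) (H : set nat).
Hypothesis hH : numerical_semigroup H.
Local Notation R := (semigroup_ring K H).

Definition monomial_pred : {pred R} := fun f => (sgval f)`_0 == 0.

Lemma monomial_ideal_closed : idealr_closed monomial_pred.
Proof.
split=> [||a u v].
- by rewrite unfold_in coef0.
- by rewrite unfold_in sgval1 coef1 oner_eq0.
rewrite !unfold_in sgvalD sgvalM coefD coef0M => /eqP-> /eqP->.
by rewrite mulr0 addr0.
Qed.

Lemma monomial_ideal_prime : prime_idealr_closed monomial_pred.
Proof. by move=> u v; rewrite !unfold_in sgvalM coef0M mulf_eq0. Qed.

Definition monomial_ideal : prime_idealr R :=
  prime_ideal_of monomial_ideal_closed monomial_ideal_prime.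

Lemma in_monomial_ideal f : (f \in monomial_ideal) = ((sgval f)`_0 == 0).
Proof. by []. Qed.

Lemma sgX_monomial_ideal h : H h -> (0 < h)%N -> sgX K H h \in monomial_ideal.
Proof. by move=> Hh; rewrite in_monomial_ideal sgXE // coefXn; case: h Hh. Qed.

Lemma monomial_ideal_maximal : maximal_ideal monomial_ideal.
Proof.
move=> I mI f fI; rewrite in_monomial_ideal; apply: contraT => f0.
apply: contraNT (sgC_notin hH I f0) => _.
rewrite -[sgC _ _](subrK f) rpredD //; apply: mI.
by rewrite in_monomial_ideal sgvalB sgCE // coefB coefC subrr.
Qed.

End MonomialIdeal.

(** * The maximum of the types over all maximal ideals *)

Theorem theorem3p1 (K : fieldType) (H : set nat) (hH : numerical_semigroup H) :
  cm_type (semigroup_ring K H) (semigroup_type H).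
Proof.
pose m := monomial_ideal K H; split=> [p pmax|]; last first.
  exists m; first exact: monomial_ideal_maximal.
  by apply: monomial_type => // h Hh h_gt0; exact: sgX_monomial_ideal.
have [pX|] := pselect (forall h, H h -> (0 < h)%N -> sgX K H h \in p).
  by exists (semigroup_type H) => //; exact: monomial_type.
move=> npX; have [h [Hh h_gt0 hp]] : exists h, [/\ H h, (0 < h)%N & sgX K H h \notin p].
  apply: contrapT => nh; apply: npX => h Hh h_gt0; apply: contraT => hp.
  by case: nh; exists h.
exists 1%N; last exact: semigroup_type_gt0.
(* A zero p would be contained in the monomial ideal; maximality of p would then force t^h into
   p. *)
have [z zp z_neq0] : exists2 z, z \in p & z <> 0.
  apply: contrapT => nz; move/negP: hp; apply.
  apply: (pmax m); last exact: sgX_monomial_ideal.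
  move=> f fp; have [->|/eqP f_neq0] := eqVneq f 0; first exact: rpred0.
  by case: nz; exists f.
exact: non_monomial_type zp z_neq0 Hh h_gt0 hp.
Qed.
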